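(* Let $m\in\mathbb N$ and $j\in\{1,2\}$. Then $r(T_m',T_{m+1}^j)=2m-4$ if $m$ is odd and $m\ge 9$, and $r(T_m',T_{m+1}^j)=2m-5$ if $m$ is even and $m\ge 16$. Moreover, if $n\in\mathbb N$, $m\ge 7$, $n\ge\max\{m+2,\,19-m\}$ and $m-1\nmid (n-4)$, then $r(T_m',T_n^j)=m+n-5$.
   Context: All graphs are finite and simple; a graph ''contains'' $H$ if it has a subgraph isomorphic to $H$. For graphs $G_1,G_2$, the Ramsey number $r(G_1,G_2)$ is the smallest positive integer $N$ such that for every graph $G$ on $N$ vertices, either $G$ contains a copy of $G_1$ or the complement $\overline G$ contains a copy of $G_2$. For $n\ge 5$, $T_n^1$ is the tree with vertex set $\{v_0,\ldots,v_{n-1}\}$ and edges $v_0v_1,\ldots,v_0v_{n-3},v_{n-4}v_{n-2},v_{n-3}v_{n-1}$, and $T_n^2$ is the tree on the same vertex set with edges $v_0v_1,\ldots,v_0v_{n-3},v_{n-3}v_{n-2},v_{n-3}v_{n-1}$. For $m\ge 4$, $T_m'$ is the unique (up to isomorphism) tree on $m$ vertices with maximum degree $m-2$. *)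

(* Defs.v *)
From mathcomp Require Import all_boot.
Set Implicit Arguments. Unset Strict Implicit. Unset Printing Implicit Defensive.

Definition symc (n : nat) (e : nat -> nat -> bool) : rel 'I_n :=
  fun x y => e (val x) (val y) || e (val y) (val x).

Definition T1 (n : nat) : rel 'I_n :=
  @symc n (fun i j => [|| (i == 0) && (1 <= j <= n - 3),
                       (i == n - 4) && (j == n - 2)
                     | (i == n - 3) && (j == n - 1)]).

Definition T2 (n : nat) : rel 'I_n :=
  @symc n (fun i j => [|| (i == 0) && (1 <= j <= n - 3),
                       (i == n - 3) && (j == n - 2)
                     | (i == n - 3) && (j == n - 1)]).

Arguments T1 : clear implicits.
Arguments T2 : clear implicits.

Definition Tj (j n : nat) : rel 'I_n := if j == 1 then T1 n else T2 n.
Arguments Tj : clear implicits.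

(* T'_m : the tree on m vertices with maximum degree m-2, i.e. the star
   v0v1,...,v0v_{m-2} with the extra edge v_{m-2}v_{m-1}. *)
Definition Tprime (m : nat) : rel 'I_m :=
  @symc m (fun i j => ((i == 0) && (1 <= j <= m - 2)) || ((i == m - 2) && (j == m - 1))).

Arguments Tprime : clear implicits.

Definition contains (k N : nat) (H : rel 'I_k) (G : rel 'I_N) : Prop :=
  exists f : 'I_k -> 'I_N, injective f /\ forall x y, H x y -> G (f x) (f y).

Definition compl (N : nat) (G : rel 'I_N) : rel 'I_N := fun x y => (x != y) && ~~ G x y.

Definition ramsey_prop (k1 k2 : nat) (H1 : rel 'I_k1) (H2 : rel 'I_k2) (N : nat) : Prop :=
  forall G : rel 'I_N, symmetric G -> irreflexive G ->
    contains H1 G \/ contains H2 (compl G).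

Definition ramsey_eq (k1 k2 : nat) (H1 : rel 'I_k1) (H2 : rel 'I_k2) (r : nat) : Prop :=
  0 < r /\ ramsey_prop H1 H2 r /\ forall N, 0 < N < r -> ~ ramsey_prop H1 H2 N.

(* Main.v *)
Require Import Defs.
From mathcomp Require Import all_boot.
From mathcomp Require Import ssralg zmodp zify.

Set Implicit Arguments.
Unset Strict Implicit.
Unset Printing Implicit Defensive.

(* A graph without T'_m is very restricted: a vertex of degree >= m-1 is the
   centre of a star component, the closed neighbourhood of a vertex of degree
   m-2 is a whole component, and all other vertices have degree <= m-3.  In
   each case a vertex of degree >= n-3 in the complement extends to T_n^j: the
   leaves of a star are pairwise adjacent in the complement, so are the vertices
   of a component and those outside it, and if all degrees are <= m-3 one counts
   the edges of the complement between the neighbours and the non-neighbours of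
   the chosen vertex.  Such a vertex exists because m-1 does not divide n-4 (the
   components cannot all have m-1 vertices), respectively because there is no
   (m-3)-regular graph of odd order when m is even.  Extremal graphs are
   (m-3)-regular, with an extra component K_{m-1} when parity forbids
   regularity.  Edges of G are called red, those of the complement blue. *)

(** * Neighbourhoods and elementary counting *)

Definition nbrs (T : finType) (G : rel T) (v : T) : {set T} := [set y | G v y].

Lemma mem_nbrs (T : finType) (G : rel T) v y : (y \in nbrs G v) = G v y.
Proof. by rewrite inE. Qed.

Lemma exists_notin_seq (T : finType) (S : {set T}) (s : seq T) :
  size s < #|S| -> exists2 x, x \in S & x \notin s.
Proof.
move=> lt_sS; case: (boolP (S \subset s)) => [sub | /subsetPn[x]]; last by exists x.
by have := leq_trans (subset_leq_card sub) (card_size s); rewrite leqNgt lt_sS.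
Qed.

Lemma cardsD2_ge (T : finType) (S : {set T}) (x y : T) :
  #|S| <= #|S :\: [set x; y]| + 2.
Proof.
rewrite -(cardsID [set x; y] S) addnC leq_add2l.
by rewrite (leq_trans (subset_leq_card (subsetIr _ _))) // cards2; case: (_ != _).
Qed.

Lemma perm_cons_cat (T : eqType) (x : T) (s1 s2 : seq T) :
  perm_eq (x :: s1 ++ s2) (s1 ++ x :: s2).
Proof. by rewrite -cat1s perm_catCA. Qed.

(** * Complements, and embedding the trees around a vertex of large degree *)

Section Graphs.
Variables (N : nat).
Implicit Types (G : rel 'I_N) (v x y : 'I_N).

Lemma compl_sym G : symmetric G -> symmetric (compl G).
Proof. by move=> sG x y; rewrite /compl eq_sym sG. Qed.

Lemma compl_irr G : irreflexive (compl G).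
Proof. by move=> x; rewrite /compl eqxx. Qed.

Lemma card_nbrs_compl G v :
  irreflexive G -> #|nbrs G v| + #|nbrs (compl G) v| + 1 = N.
Proof.
move=> iG; rewrite -[RHS]card_ord -cardsT -(cardsID (nbrs G v) setT) setTI -addnA.
congr (_ + _); rewrite setTD [RHS](cardsD1 v) !inE iG /= addnC; congr (_ + _).
by apply: eq_card => y; rewrite !inE /compl (eq_sym v).
Qed.

(** A copy is given as a list whose [i]-th entry is the image of vertex [i]. Since [G] is symmetric,
    only one orientation of each edge is checked; [x0] is just the default of [nth]. *)
Lemma contains_seq k (e : nat -> nat -> bool) G x0 (s : seq 'I_N) :
  symmetric G -> uniq s -> size s = k ->
  (forall i j, i < k -> j < k -> e i j -> G (nth x0 s i) (nth x0 s j)) ->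
  contains (@symc k e) G.
Proof.
move=> sG us sz eG; exists (fun i => nth x0 s (val i)); split.
  move=> i j /eqP; rewrite nth_uniq ?sz ?ltn_ord // => /eqP; exact: val_inj.
by move=> i j /orP[] ?; [|rewrite sG]; apply: eG => //; apply: ltn_ord.
Qed.

Lemma contains_Tprime m G v u w :
  symmetric G -> irreflexive G -> 3 <= m -> G v u -> G u w -> w != v ->
  m - 2 <= #|nbrs G v :\ w| -> contains (Tprime m) G.
Proof.
move=> sG iG m3 vu uw wv deg.
(* The leaves other than [u]. In the list below, [u] and [w] occupy positions [m - 2] and [m - 1],
   the ends of the extra edge. *)
pose L := take (m - 3) (enum (nbrs G v :\ w :\ u)).
have uNw : u != w by apply: contraTneq uw => ->; rewrite iG.
have szL : size L = m - 3.
  rewrite size_take -cardE.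
  move: deg; rewrite (cardsD1 u (_ :\ w)) !inE uNw vu /=.
  by move: #|_| m3; clear=> k ? ?; case: ltnP; lia.
have LP x : x \in L -> [/\ x != u, x != w & G v x].
  by move=> /mem_take; rewrite mem_enum !inE => /and3P[].
have Lu : uniq L by rewrite take_uniq ?enum_uniq.
apply: (@contains_seq _ _ _ v (v :: L ++ [:: u; w])) => //.
- rewrite (perm_uniq (perm_cons_cat v L _)).
  have vNu : v != u by apply: contraTneq vu => ->; rewrite iG.
  rewrite cat_uniq Lu /= !inE uNw (negPf vNu) (eq_sym v w) (negPf wv) !andbT.
  by rewrite !negb_or; apply/and4P; split => //; apply/negP => /LP[]; rewrite ?eqxx ?iG.
- by rewrite /= size_cat szL /=; lia.
move=> i j _ _ /orP[/andP[/eqP-> /andP[]]|/andP[/eqP-> /eqP->]].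
  case: j => // j _ jm /=; rewrite nth_cat szL; case: ltnP => jL.
    by have /(mem_nth v)/LP[] // : j < size L by rewrite szL.
  by have -> : j - (m - 3) = 0 by lia.
have [-> ->] : m - 2 = (m - 3).+1 /\ m - 1 = (m - 3).+2 by lia.
by rewrite /= !nth_cat szL ltnn ltnNge leqnSn /= subnn subSnn.
Qed.

(** The degree is counted without [c1] and [c2], so [n - 5] leaves remain beside [b1] and [b2];
    these four end the list, at positions [n - 4] to [n - 1]. *)
Lemma contains_T1 n G v b1 b2 c1 c2 :
  symmetric G -> irreflexive G -> 5 <= n -> uniq [:: v; b1; b2; c1; c2] ->
  G v b1 -> G v b2 -> G b1 c1 -> G b2 c2 ->
  n - 3 <= #|nbrs G v :\: [set c1; c2]| -> contains (T1 n) G.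
Proof.
move=> sG iG n5 un vb1 vb2 bc1 bc2 deg.
pose L := take (n - 5) (enum (nbrs G v :\: [set c1; c2] :\ b1 :\ b2)).
move: (un); rewrite /= !inE !negb_or.
move=> /and5P[/and4P[nvb1 nvb2 nvc1 nvc2] /and3P[nb12 nb1c1 nb1c2] /andP[nb2c1 nb2c2] nc12 _].
have szL : size L = n - 5.
  rewrite size_take -cardE.
  move: deg; rewrite (cardsD1 b1) (cardsD1 b2 (_ :\ _)) !inE vb1 vb2.
  rewrite (negPf nb1c1) (negPf nb1c2) (negPf nb2c1) (negPf nb2c2) (eq_sym b2) nb12 /=.
  by move: #|_| n5; clear=> k ? ?; case: ltnP; lia.
have LP x : x \in L -> [/\ x != b1, x != b2, x != c1, x != c2 & G v x].
  move=> /mem_take; rewrite mem_enum !inE negb_or.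
  by move=> /and4P[? ? /andP[? ?] ?]; split.
have Lu : uniq L by rewrite take_uniq ?enum_uniq.
apply: (@contains_seq _ _ _ v (v :: (L ++ [:: b1; b2]) ++ [:: c1; c2])) => //.
- rewrite -catA (perm_uniq (perm_cons_cat v L _)).
  rewrite cat_uniq Lu un andbT andTb; apply/hasPn => x.
  by rewrite !inE => /or4P[| | |/orP[]] /eqP->; apply/negP => /LP[]; rewrite ?eqxx ?iG.
- by rewrite /= !size_cat szL /=; clear - n5; lia.
have szP : size (L ++ [:: b1; b2]) = n - 3 by rewrite size_cat szL /=; clear - n5; lia.
have nthb : nth v (v :: (L ++ [:: b1; b2]) ++ [:: c1; c2]) (n - 3) = b2.
  have -> : n - 3 = (n - 5).+2 by (clear - n5; lia).
  rewrite /= nth_cat szP ifT; last by (clear - n5; lia).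
  by rewrite nth_cat szL ltnNge leqnSn subSnn.
move=> i j _ _ /or3P[/andP[/eqP-> /andP[]]|/andP[/eqP-> /eqP->]|/andP[/eqP-> /eqP->]].
- case: j => // j _ jm /=; rewrite nth_cat szP jm nth_cat szL; case: ltnP => jL.
    by have /(mem_nth v)/LP[] // : j < size L by rewrite szL.
  by have [->|->] : j - (n - 5) = 0 \/ j - (n - 5) = 1 by (clear - n5 jm jL; lia).
- have [-> ->] : n - 4 = (n - 5).+1 /\ n - 2 = (n - 3).+1 by (clear - n5; lia).
  rewrite /= [nth _ _ (n - 3)]nth_cat szP ltnn subnn nth_cat szP ifT; last by (clear - n5; lia).
  by rewrite nth_cat szL ltnn subnn.
rewrite nthb (_ : n - 1 = (n - 3).+2) /=; last by (clear - n5; lia).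
by rewrite nth_cat szP ltnNge leqnSn subSnn.
Qed.

Lemma contains_T2 n G v b c1 c2 :
  symmetric G -> irreflexive G -> 4 <= n -> uniq [:: v; b; c1; c2] ->
  G v b -> G b c1 -> G b c2 ->
  n - 3 <= #|nbrs G v :\: [set c1; c2]| -> contains (T2 n) G.
Proof.
move=> sG iG n4 un vb bc1 bc2 deg.
pose L := take (n - 4) (enum (nbrs G v :\: [set c1; c2] :\ b)).
move: (un); rewrite /= !inE !negb_or.
move=> /and4P[/and3P[nvb nvc1 nvc2] /andP[nbc1 nbc2] nc12 _].
have szL : size L = n - 4.
  rewrite size_take -cardE.
  move: deg; rewrite (cardsD1 b) !inE vb (negPf nbc1) (negPf nbc2) /=.
  by move: #|_| n4; clear=> k ? ?; case: ltnP; lia.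
have LP x : x \in L -> [/\ x != b, x != c1, x != c2 & G v x].
  move=> /mem_take; rewrite mem_enum !inE negb_or.
  by move=> /and3P[? /andP[? ?] ?]; split.
have Lu : uniq L by rewrite take_uniq ?enum_uniq.
apply: (@contains_seq _ _ _ v (v :: (L ++ [:: b]) ++ [:: c1; c2])) => //.
- rewrite -catA (perm_uniq (perm_cons_cat v L _)).
  rewrite cat_uniq Lu un andbT andTb; apply/hasPn => x.
  by rewrite !inE => /or4P[] /eqP->; apply/negP => /LP[]; rewrite ?eqxx ?iG.
- by rewrite /= !size_cat szL /=; clear - n4; lia.
have szP : size (L ++ [:: b]) = n - 3 by rewrite size_cat szL /=; clear - n4; lia.
have nthb : nth v (v :: (L ++ [:: b]) ++ [:: c1; c2]) (n - 3) = b.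
  have -> : n - 3 = (n - 4).+1 by (clear - n4; lia).
  by rewrite /= nth_cat szP ifT ?nth_cat ?szL ?ltnn ?subnn //; clear - n4; lia.
move=> i j _ _ /or3P[/andP[/eqP-> /andP[]]|/andP[/eqP-> /eqP->]|/andP[/eqP-> /eqP->]].
- case: j => // j _ jm /=; rewrite nth_cat szP jm nth_cat szL; case: ltnP => jL.
    by have /(mem_nth v)/LP[] // : j < size L by rewrite szL.
  by have -> : j - (n - 4) = 0 by (clear - n4 jm jL; lia).
- rewrite nthb (_ : n - 2 = (n - 3).+1) /=; last by (clear - n4; lia).
  by rewrite nth_cat szP ltnn subnn.
rewrite nthb (_ : n - 1 = (n - 3).+2) /=; last by (clear - n4; lia).
by rewrite nth_cat szP ltnNge leqnSn subSnn.
Qed.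

(** The path [c1 b1 c2 b2] serves both trees: the first uses [b1 c1] and [b2 c2], the second [b1 c1]
    and [b1 c2]. *)
Lemma contains_Tj_K22 j n G v b1 b2 c1 c2 :
  symmetric G -> irreflexive G -> 5 <= n -> uniq [:: v; b1; b2; c1; c2] ->
  G v b1 -> G v b2 -> G b1 c1 -> G b1 c2 -> G b2 c2 ->
  n - 3 <= #|nbrs G v :\: [set c1; c2]| -> contains (Tj j n) G.
Proof.
move=> sG iG n5 un vb1 vb2 b1c1 b1c2 b2c2 deg; rewrite /Tj; case: ifP => _.
  exact: (@contains_T1 _ _ v b1 b2 c1 c2).
apply: (@contains_T2 _ _ v b1 c1 c2) => //; first by lia.
exact: (mask_uniq un [:: true; true; false; true; true]).
Qed.

End Graphs.

Lemma handshake N (G : rel 'I_N) :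
  symmetric G -> irreflexive G -> ~~ odd (\sum_v #|nbrs G v|).
Proof.
move=> sG iG.
(* [S] counts each edge once, at its smaller endpoint. *)
pose S := \sum_(x < N) \sum_(y < N) (G x y && (x < y)).
suff -> : \sum_v #|nbrs G v| = S + S by rewrite oddD addbb.
rewrite {2}/S exchange_big -big_split; apply: eq_bigr => x _ /=.
rewrite -big_split -sum1_card big_mkcond; apply: eq_bigr => y _ /=.
rewrite inE (sG y x); case: (ltngtP x y) => [| |/val_inj->]; last by rewrite iG.
  all: by rewrite ?andbT ?andbF; case: (G x y).
Qed.

(** * Red graphs without [Tprime m]: vertices of large degree *)

Section NoTprime.
Variables (N m : nat) (G : rel 'I_N).
Hypotheses (sG : symmetric G) (iG : irreflexive G) (m_gt6 : 7 <= m).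
Hypothesis noT : ~ contains (Tprime m) G.

Let H := compl G.
Let sH : symmetric H := compl_sym sG.
Let iH : irreflexive H := @compl_irr _ G.

(** Otherwise at least [m - 2] neighbours of [v] remain after removing [w], and the path [v u w]
    completes a copy of [Tprime m]. *)
Lemma star_of_large_degree v u w :
  m - 1 <= #|nbrs G v| -> G v u -> G u w -> w = v.
Proof.
move=> dv vu uw; apply/eqP; apply: contra_notT noT => wv.
apply: (@contains_Tprime _ _ _ v u w) => //; first by lia.
by move: dv; rewrite (cardsD1 w); move: (_ \in _) #|_|; clear; lia.
Qed.

(** A vertex [w] outside is not among the [m - 2] neighbours of [v], so it could serve as the vertex
    at distance two from the centre. *)
Lemma closed_nbrs_large_degree v u w :
  m - 2 <= #|nbrs G v| -> u \in v |: nbrs G v -> G u w -> w \in v |: nbrs G v.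
Proof.
move=> dv; rewrite !inE => /orP[/eqP-> ->|vu uw]; first by rewrite orbT.
apply: contra_notT noT; rewrite negb_or => /andP[wv vw].
apply: (@contains_Tprime _ _ _ v u w) => //; first by lia.
by move: dv; rewrite (cardsD1 w) inE (negPf vw).
Qed.

Lemma card_clnbrs v : #|v |: nbrs G v| = #|nbrs G v|.+1.
Proof. by rewrite cardsU1 inE iG. Qed.

(** When [c1] and [c2] are red neighbours of the blue centre [v], excluding them from its leaves
    costs nothing. *)
Lemma disjoint_nbrs_compl v c1 c2 :
  c1 \in nbrs G v -> c2 \in nbrs G v -> nbrs H v :\: [set c1; c2] = nbrs H v.
Proof.
move=> c1v c2v; apply/setDidPl; rewrite disjoint_sym disjoints_subset.
apply/subsetP => c; move: c1v c2v; rewrite !inE /H /compl => c1v c2v.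
by case/orP => /eqP->; rewrite ?c1v ?c2v andbF.
Qed.

Lemma blue_of_star j n v :
  5 <= n -> n < N -> m - 1 <= #|nbrs G v| -> contains (Tj j n) H.
Proof.
move=> n5 nN dv.
(* Five leaves of the star, pairwise blue, carry the core of the tree. The centre [l] has [v] as its
   only red neighbour, so at least [N - 4] blue neighbours remain without [c1] and [c2]. *)
have [s [us ss sub]] : exists s, [/\ uniq s, size s = 5 & {subset s <= nbrs G v}].
  by apply/card_geqP; apply: leq_trans dv; lia.
have blue x y : x \in s -> y \in s -> x != y -> H x y.
  move=> xs ys xy; rewrite /H /compl xy /=; apply: contraTN (sub _ ys) => Gxy.
  by rewrite inE (star_of_large_degree dv _ Gxy) ?iG // -mem_nbrs sub.
case: s us ss sub blue => [|l [|b1 [|b2 [|c1 [|c2 [|]]]]]] // us _ sub blue.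
have [? ? ? ? ?] : [/\ H l b1, H l b2, H b1 c1, H b1 c2 & H b2 c2].
  move: us; rewrite /= !inE !negb_or.
  move=> /and5P[/and4P[? ? ? ?] /and3P[? ? ?] /andP[? ?] ? _].
  by split; apply: blue; rewrite // !inE eqxx ?orbT.
apply: (@contains_Tj_K22 _ _ _ _ l b1 b2 c1 c2) => //.
have vl : G v l by rewrite -mem_nbrs sub // mem_head.
have : #|nbrs G l| <= #|[set v]|.
  by apply/subset_leq_card/subsetP => y; rewrite !inE => /(star_of_large_degree dv vl)->.
have := card_nbrs_compl l iG; have := cardsD2_ge (nbrs H l) c1 c2.
rewrite cards1 -/H; move: #|_| #|_| #|_| nN; clear; lia.
Qed.

(** The blue tree is centred at [w], outside the component [C] of [v]; [v] and [b2] lie in [C],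
    while [c1] and [c2] lie outside, so every edge needed between the two sides is blue. *)
Lemma blue_of_closed j n v w :
  5 <= n -> n < N -> m + 2 <= N -> #|nbrs G v| = m - 2 ->
  w \notin v |: nbrs G v -> #|nbrs G w| + n <= N + 2 -> contains (Tj j n) H.
Proof.
move=> n5 nN mN dv; set C := v |: nbrs G v => wC dw.
have cl x y : x \in C -> y \notin C -> H x y.
  move=> xC yC; rewrite /H /compl (memPn yC) //=.
  by apply: contra yC; apply: closed_nbrs_large_degree; rewrite ?dv.
have [b2 b2v] : exists b, b \in nbrs G v by apply/card_gt0P; rewrite dv; lia.
have vC : v \in C by rewrite !inE eqxx.
have bC : b2 \in C by rewrite inE b2v orbT.
have [c1 [c2 [c12 c1C c2C [wc1 wc2 cB]]]] : exists c1 c2,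
    [/\ c1 != c2, c1 \notin C, c2 \notin C
      & [/\ w != c1, w != c2 & n - 3 <= #|nbrs H w :\: [set c1; c2]|]].
  have cw := card_nbrs_compl w iG.
  (* Two red neighbours of [w] do not reduce its blue degree. If there is at most one, the blue
     degree is at least [N - 2] and any two vertices outside [C] will do. *)
  case: (ltnP 1 #|nbrs G w|) => [/card_gt1P[c1 [c2 [c1w c2w c12]]]|dw1].
    have nbC c : c \in nbrs G w -> c \notin C.
      rewrite inE sG => cw'; apply: contra wC => cC.
      by apply: closed_nbrs_large_degree cC cw'; rewrite dv.
    exists c1, c2; split; rewrite ?nbC //; split.
    - by apply: contraTneq c1w => <-; rewrite inE iG.
    - by apply: contraTneq c2w => <-; rewrite inE iG.
    by rewrite disjoint_nbrs_compl //; move: cw dw; rewrite -/H; move: #|_| #|_|; clear; lia.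
  have /card_gt1P[c1 [c2 [c1D c2D c12]]] : 1 < #|~: C :\ w|.
    have := cardsC C; rewrite card_clnbrs dv card_ord (cardsD1 w (~: C)) in_setC wC.
    by move: #|_| m_gt6 mN; clear; lia.
  move: c1D c2D; rewrite !in_setD1 !in_setC => /andP[c1w c1C] /andP[c2w c2C].
  exists c1, c2; split => //; split; rewrite 1?eq_sym //.
  have := cardsD2_ge (nbrs H w) c1 c2; move: dw1 cw nN; rewrite -/H.
  by move: #|_| #|_| #|_|; clear; lia.
have vb : v != b2 by apply: contraTneq b2v => <-; rewrite inE iG.
have bw : w != b2 by apply: contraNneq wC => ->.
have vw : w != v by apply: contraNneq wC => ->.
apply: (@contains_Tj_K22 _ _ _ _ w v b2 c1 c2); rewrite ?(sH w) ?cl //.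
by rewrite /= !inE !negb_or vw bw wc1 wc2 vb c12 !(memPn c1C) ?(memPn c2C).
Qed.

(** * All red degrees at most [m - 3] *)

Section SmallDegrees.
Variables (n : nat) (v : 'I_N).
Hypotheses (m_lt_n : m < n) (n_lt_N : n < N).
Hypothesis small : forall x, #|nbrs G x| <= m - 3.
Hypothesis dv : #|nbrs G v| + n <= N + 2.

Let A := nbrs G v.
Let B := nbrs H v.

Lemma blue_degree_gt3 x : 3 < #|nbrs H x|.
Proof.
have := card_nbrs_compl x iG; have := small x; rewrite -/H.
by move: #|_| #|_| m_lt_n n_lt_N m_gt6; clear; lia.
Qed.

Lemma card_blue_nbrs_ge : n - 3 <= #|B|.
Proof.
have := card_nbrs_compl v iG; move: dv; rewrite -/H -/B.
by move: #|_| #|_|; clear; lia.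
Qed.

(* [a] has at most [m - 4] red neighbours in [B], because [v] is another one. *)
Lemma blue_nbrs_in_B a : a \in A -> #|B| <= #|B :&: nbrs H a| + (m - 4).
Proof.
rewrite inE => va; rewrite -(cardsID (nbrs H a) B) leq_add2l.
have : #|B :\: nbrs H a| <= #|nbrs G a :\ v|.
  apply/subset_leq_card/subsetP => y; rewrite !inE /H /compl.
  case: (eqVneq a y) => [<-|_] /=; first by rewrite va andbF.
  by rewrite negbK => /and3P[-> vy _]; rewrite eq_sym vy.
have := small a; rewrite (cardsD1 v) inE sG va.
by move: #|_| #|_|; clear; lia.
Qed.

(** With [n - 1] blue neighbours, [v] can spare two of them, so [c1] and [c2] are almost arbitrary.
    Otherwise they are taken in [A], and each has at least two blue neighbours in [B], which allows
    distinct [b1] and [b2]. *)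
Lemma blue_T1 : 1 < #|A| \/ n - 1 <= #|B| -> contains (T1 n) H.
Proof.
move=> AB.
have n5 : 5 <= n by move: m_lt_n m_gt6; clear; lia.
have Bn := card_blue_nbrs_ge.
have [bigB|smallB] := leqP (n - 1) #|B|.
  have /card_gt1P[b1 [b2 [b1B b2B b12]]] : 1 < #|B|.
    by move: bigB n5; clear; lia.
  (* The repeated entry only pads the list to length three, to match the degree bound. *)
  have [c1 c1b] := exists_notin_seq (blue_degree_gt3 b1 : size [:: v; b2; b2] < _).
  rewrite !inE !negb_or => /and3P[c1v c1b2 _].
  have [c2 c2b] := exists_notin_seq (blue_degree_gt3 b2 : size [:: v; b1; c1] < _).
  rewrite !inE !negb_or => /and3P[c2v c2b1 c2c1].
  move: b1B b2B c1b c2b; rewrite !inE => b1B b2B c1b c2b.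
  apply: (@contains_T1 _ _ _ v b1 b2 c1 c2) => //.
    rewrite /= !inE !negb_or b12 ![v == _]eq_sym c1v c2v (eq_sym b2 c1) c1b2.
    rewrite (eq_sym b1 c2) c2b1 (eq_sym c1 c2) c2c1.
    case/andP: b1B; case/andP: b2B; case/andP: c1b; case/andP: c2b.
    by rewrite ![v == _]eq_sym => -> _ -> _ -> _ -> _.
  have := cardsD2_ge B c1 c2; move: bigB; rewrite -/B.
  by move: #|_| #|_|; clear; lia.
case: AB => [/card_gt1P[c1 [c2 [c1A c2A c12]]]|]; last by rewrite leqNgt smallB.
have [b1] : exists b, b \in B :&: nbrs H c1.
  apply/card_gt0P; have := blue_nbrs_in_B c1A.
  by move: #|_| #|_| Bn m_lt_n m_gt6; clear; lia.
rewrite in_setI => /andP[b1B b1c].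
have [b2] : exists2 b, b \in B :&: nbrs H c2 & b \notin [:: b1].
  apply: exists_notin_seq; have /= := blue_nbrs_in_B c2A.
  by move: #|_| #|_| Bn m_lt_n m_gt6; clear; lia.
rewrite in_setI mem_seq1 => /andP[b2B b2c] b21.
have nAB b c : b \in B -> c \in A -> b != c.
  by rewrite !inE /H /compl => /andP[_ bB] cA; apply: contraNneq bB => ->.
have vB b : b \in B -> v != b by rewrite inE => /andP[].
have vA c : c \in A -> v != c by rewrite inE => vc; apply: contraTneq vc => <-; rewrite iG.
apply: (@contains_T1 _ _ _ v b1 b2 c1 c2) => //.
- by rewrite /= !inE !negb_or (eq_sym b1 b2) b21 c12 (vB _ b1B) (vB _ b2B) ?vA // !nAB.
- by rewrite -mem_nbrs.
- by rewrite -mem_nbrs.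
- by rewrite sH -mem_nbrs.
- by rewrite sH -mem_nbrs.
by rewrite disjoint_nbrs_compl.
Qed.

Lemma blue_T2 : m - 4 < (N - n) * 2 -> contains (T2 n) H.
Proof.
move=> Nn.
have n4 : 4 <= n by move: m_lt_n m_gt6; clear; lia.
have Bn := card_blue_nbrs_ge.
have [bigB|smallB] := leqP (n - 1) #|B|.
  have [b bB] : exists b, b \in B.
    by apply/card_gt0P; move: bigB n4; clear; lia.
  have [c1 c1b] := exists_notin_seq (blue_degree_gt3 b : size [:: v; v; v] < _).
  rewrite !inE !negb_or => /andP[c1v _].
  have [c2 c2b] := exists_notin_seq (blue_degree_gt3 b : size [:: v; c1; c1] < _).
  rewrite !inE !negb_or => /and3P[c2v c2c1 _].
  move: bB c1b c2b; rewrite !inE => bB c1b c2b.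
  apply: (@contains_T2 _ _ _ v b c1 c2) => //.
    rewrite /= !inE !negb_or ![v == _]eq_sym c1v c2v (eq_sym c1 c2) c2c1.
    case/andP: bB; case/andP: c1b; case/andP: c2b.
    by rewrite ![v == _]eq_sym => -> _ -> _ -> _.
  have := cardsD2_ge B c1 c2; move: bigB; rewrite -/B.
  by move: #|_| #|_|; clear; lia.
(* Double counting of the blue edges between [A] and [B]: if each [b] had at most one, there would
   be at most [#|B|], yet each [a] contributes at least [#|B| - (m - 4)]. As [#|B|] is [n - 3] or
   [n - 2], this contradicts [Nn]. *)
have [b bB dA] : exists2 b, b \in B & 1 < #|A :&: nbrs H b|.
  apply/exists_inP; apply: contraT => /exists_inPn/= le1.
  have count a (S : {set 'I_N}) : #|S :&: nbrs H a| = \sum_(b in S) (H b a).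
    rewrite -sum1_card big_mkcond [RHS]big_mkcond; apply: eq_bigr => b _.
    by rewrite !inE sH; case: (b \in S); case: (H b a).
  have : \sum_(b in B) #|A :&: nbrs H b| <= \sum_(b in B) 1.
    by apply: leq_sum => b /le1; rewrite -leqNgt.
  rewrite sum1_card; under eq_bigr => b _ do rewrite count.
  rewrite exchange_big /= => leB.
  have : \sum_(a in A) (#|B| - (m - 4)) <= #|B|.
    apply: leq_trans leB; apply: leq_sum => a aA; under eq_bigr => b _ do rewrite sH.
    by rewrite -count leq_subLR addnC blue_nbrs_in_B.
  rewrite sum_nat_const.
  have := card_nbrs_compl v iG; rewrite -/H -/A -/B.
  move: #|A| #|B| smallB Bn Nn n_lt_N m_lt_n m_gt6; clear => a b; nia.
have /card_gt1P[c1 [c2 []]] := dA.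
rewrite !in_setI => /andP[c1A c1b] /andP[c2A c2b] c12.
have nAB c : c \in A -> b != c.
  by move: bB; rewrite !inE /H /compl => /andP[_ bB] cA; apply: contraNneq bB => ->.
have vB : v != b by move: bB; rewrite inE => /andP[].
have vA c : c \in A -> v != c by rewrite inE => vc; apply: contraTneq vc => <-; rewrite iG.
apply: (@contains_T2 _ _ _ v b c1 c2) => //.
- by rewrite /= !inE !negb_or c12 vB !nAB // !vA.
- by rewrite -mem_nbrs.
- by rewrite -mem_nbrs.
- by rewrite -mem_nbrs.
by rewrite disjoint_nbrs_compl.
Qed.

Lemma blue_of_small_degrees j : m - 4 < (N - n) * 2 -> contains (Tj j n) H.
Proof.
move=> Nn; rewrite /Tj; case: ifP => _; last exact: blue_T2.
apply: blue_T1.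
have := card_nbrs_compl v iG; rewrite -/H -/A -/B.
by move: #|_| #|_| Nn m_gt6; clear; lia.
Qed.

End SmallDegrees.

(** * Case split on the largest red degree *)

(** Common core of both upper bounds. A red degree of at most [N + 2 - n] means a blue degree of at
    least [n - 3]; the last two hypotheses leave the existence of such a vertex to be proved by
    divisibility or parity. *)
Lemma blue_Tj j n :
  m < n -> m - 4 < (N - n) * 2 ->
  ((forall x, #|nbrs G x| <= m - 2) -> forall v, #|nbrs G v| = m - 2 ->
     exists2 w, w \notin v |: nbrs G v & #|nbrs G w| + n <= N + 2) ->
  ((forall x, #|nbrs G x| <= m - 3) -> exists v, #|nbrs G v| + n <= N + 2) ->
  contains (Tj j n) H.
Proof.
move=> mn Nn medium small.
have n5 : 5 <= n by lia.
have nN : n < N by lia.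
have [/existsP[v dv]|/existsPn/= le2] := boolP [exists v, m - 1 <= #|nbrs G v|].
  exact: blue_of_star dv.
have {}le2 x : #|nbrs G x| <= m - 2.
  by have := le2 x; rewrite -ltnNge; move: #|_| m_gt6; clear; lia.
have [/existsP[v /eqP dv]|/existsPn/= le3] := boolP [exists v, #|nbrs G v| == m - 2].
  have [w wC dw] := medium le2 v dv.
  by apply: (blue_of_closed _ _ _ _ dv wC dw) => //; lia.
have {}le3 x : #|nbrs G x| <= m - 3.
  by have := le3 x; have := le2 x; move: #|_| m_gt6; clear; lia.
have [v dv] := small le3.
exact: (blue_of_small_degrees mn nN le3 dv).
Qed.

(** Otherwise the closed neighbourhoods of the vertices outside are components of [m - 1] vertices
    each, and they partition the remaining [N - (m - 1)] vertices. *)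
Lemma exists_small_degree_outside v :
  #|nbrs G v| = m - 2 -> (forall x, #|nbrs G x| <= m - 2) ->
  ~~ (m - 1 %| N - (m - 1)) ->
  exists2 w, w \notin v |: nbrs G v & #|nbrs G w| <= m - 3.
Proof.
move=> dv le2 ndvd; set D := ~: (v |: nbrs G v).
have [/exists_inP[w wD dw]|/exists_inPn/= big] :=
  boolP [exists w in D, #|nbrs G w| <= m - 3].
  by exists w => //; rewrite -in_setC.
have deg x : x \in D -> #|nbrs G x| = m - 2.
  by move=> /big; have := le2 x; move: #|_|; clear; lia.
pose R x y := y \in x |: nbrs G x.
have symR x y : R x y -> R y x by rewrite /R !inE eq_sym sG.
have subR x y z : m - 2 <= #|nbrs G x| -> R x y -> R y z -> R x z.
  move=> dx xy; rewrite {1}/R !inE => /orP[/eqP->|] //.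
  exact: closed_nbrs_large_degree.
have eqR : {in D & &, equivalence_rel R}.
  move=> x y z /deg dx /deg dy _; split; first by rewrite /R !inE eqxx.
  move=> xy; apply/idP/idP; apply: subR; rewrite ?dx ?dy //; exact: symR.
have part := equivalence_partitionP eqR.
have blocks : {in equivalence_partition R D, forall S : {set 'I_N}, #|S| = m - 1}.
  move=> _ /imsetP[x xD ->].
  transitivity #|x |: nbrs G x|; last by rewrite card_clnbrs deg //; lia.
  (* Blocks are cut out of [D], but a closed neighbourhood meeting the component of [v] would put
     [x] into that component. *)
  apply: eq_card => y; rewrite inE -/(R x y) andb_idl // => xy.
  move: xD; rewrite !in_setC; apply: contra => yC.
  by apply: (subR _ y); rewrite ?dv // symR.
have : #|D| = N - (m - 1).
  by have := cardsC (v |: nbrs G v); rewrite card_clnbrs dv card_ord -/D; lia.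
rewrite (card_uniform_partition blocks part) => eqN.
by rewrite -eqN dvdn_mull in ndvd.
Qed.

End NoTprime.

(** * Upper bounds for the Ramsey numbers *)

(** Makes containment decidable, which provides the case split in [ramsey_propI] without classical
    axioms. *)
Lemma containsP k N (H : rel 'I_k) (G : rel 'I_N) :
  reflect (contains H G)
    [exists f : {ffun 'I_k -> 'I_N},
       injectiveb f && [forall x, forall y, H x y ==> G (f x) (f y)]].
Proof.
apply: (iffP existsP) => [[f /andP[/injectiveP injf /forallP homf]]|[f [injf homf]]].
  by exists f; split=> // x y; apply/implyP; move/forallP: (homf x); apply.
exists (finfun f); apply/andP; split.
  by apply/injectiveP => x y; rewrite !ffunE => /injf.
by apply/forallP => x; apply/forallP => y; rewrite !ffunE; apply/implyP/homf.
Qed.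

Lemma ramsey_propI k1 k2 (H1 : rel 'I_k1) (H2 : rel 'I_k2) N :
  (forall G : rel 'I_N, symmetric G -> irreflexive G ->
     ~ contains H1 G -> contains H2 (compl G)) -> ramsey_prop H1 H2 N.
Proof.
move=> P G sG iG; case: (containsP H1 G) => [|notH1]; first by left.
by right; apply: P.
Qed.

(** Restrict the larger graph to its first [N] vertices. A lower bound thus needs only one graph, of
    the largest order. *)
Lemma ramsey_prop_mono k1 k2 (H1 : rel 'I_k1) (H2 : rel 'I_k2) N M :
  N <= M -> ramsey_prop H1 H2 N -> ramsey_prop H1 H2 M.
Proof.
move=> leNM RN G sG iG; pose w := widen_ord leNM.
have injw : injective w by move=> x y /(congr1 val) /= /val_inj.
case: (RN (fun x y => G (w x) (w y))) => [x y|x|[f [injf homf]]|[f [injf homf]]].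
- exact: sG.
- exact: iG.
- by left; exists (w \o f); split => [x y /injw/injf|x y /homf].
- right; exists (w \o f); split => [x y /injw/injf //|x y /homf].
  by rewrite /compl (inj_eq injw).
Qed.

Lemma ramsey_prop_Tprime_Tj m n j :
  7 <= m -> m < n -> ~~ (m - 1 %| n - 4) ->
  ramsey_prop (Tprime m) (Tj j n) (m + n - 5).
Proof.
move=> m7 mn ndvd; apply: ramsey_propI => G sG iG noT.
(* Here [N + 2 - n] equals [m - 3], and [n - 4] vertices lie outside a component of [m - 1]
   vertices. *)
apply: (@blue_Tj _ m) => // [|le2 v dv|le3].
- by clear - m7 mn; lia.
- have [|w wC dw] := exists_small_degree_outside sG iG m7 noT dv le2.
    by have -> : m + n - 5 - (m - 1) = n - 4 by (clear - m7 mn; lia).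
  by exists w => //; move: dw m7; move: #|_|; clear; lia.
have N_gt0 : 0 < m + n - 5 by (clear - m7 mn; lia).
exists (Ordinal N_gt0); have := le3 (Ordinal N_gt0).
by move: #|_| m7; clear; lia.
Qed.

Lemma ramsey_prop_Tprime_Tj_even m j :
  16 <= m -> ~~ odd m -> ramsey_prop (Tprime m) (Tj j (m + 1)) (2 * m - 5).
Proof.
move=> m16 evm; apply: ramsey_propI => G sG iG noT.
have m7 : 7 <= m by clear - m16; lia.
apply: (@blue_Tj _ m) => // [| |le2 v dv|le3].
- by clear; lia.
- by clear - m16; lia.
(* Only [m - 4] vertices lie outside the component, so [w] has red degree at most [m - 5]; the bound
   needed is [m - 4]. *)
- have [w wC] : exists w, w \in ~: (v |: nbrs G v).
    apply/card_gt0P; have := cardsC (v |: nbrs G v).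
    by rewrite card_clnbrs // dv card_ord; move: #|_| m16; clear; lia.
  exists w; first by rewrite -in_setC.
  have : #|nbrs G w| <= #|~: (v |: nbrs G v) :\ w|.
    apply/subset_leq_card/subsetP => y yw; rewrite in_setD1; apply/andP; split.
      by apply: contraTneq yw => ->; rewrite inE iG.
    move: wC; rewrite !in_setC; apply: contra => yC.
    apply: (closed_nbrs_large_degree sG iG m7 noT _ yC); first by rewrite dv.
    by rewrite sG -mem_nbrs.
  have := cardsC (v |: nbrs G v); rewrite card_clnbrs // dv card_ord (cardsD1 w (~: _)) wC.
  by move: #|_| #|_| m16; clear; lia.
have [/existsP[v dv]|/existsPn/= big] := boolP [exists v, #|nbrs G v| <= m - 4].
  by exists v; move: dv; move: #|_| m16; clear; lia.
have deg v : #|nbrs G v| = m - 3.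
  by have := le3 v; have := big v; move: #|_| m16; clear; lia.
(* The order [2 * m - 5] and the degree [m - 3] are both odd. *)
have := handshake sG iG; under eq_bigr => v _ do rewrite deg.
rewrite sum_nat_const card_ord oddM; clear - m16 evm; lia.
Qed.

(** * Necessary conditions for containing the trees *)

Section NoRamsey.
Variable N : nat.
Implicit Types G : rel 'I_N.

Lemma contains_center_degree k (H : rel 'I_k) G (f : 'I_k -> 'I_N) (o : 'I_k) d :
  injective f -> (forall x y, H x y -> G (f x) (f y)) -> d < k ->
  (forall i : 'I_k, 0 < i <= d -> H o i) -> d <= #|nbrs G (f o)|.
Proof.
move=> injf homf dk Ho.
have lt_k (i : 'I_d) : i.+1 < k by apply: leq_trans dk; apply: ltn_ord.
pose g i := f (Ordinal (lt_k i)).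
have injg : injective g by move=> x y /injf/(congr1 val)[] /val_inj.
rewrite -{1}(card_ord d) -cardsT -(card_imset _ injg); apply/subset_leq_card.
by apply/subsetP => _ /imsetP[i _ ->]; rewrite inE homf // Ho //= ltn_ord.
Qed.

Lemma contains_Tj_degree j n G :
  5 <= n -> contains (Tj j n) G -> exists v, n - 3 <= #|nbrs G v|.
Proof.
move=> n5 [f [injf homf]]; have n0 : 0 < n by apply: leq_trans n5.
exists (f (Ordinal n0)); apply: contains_center_degree injf homf _ _ => [|i i_n].
  by clear - n5; lia.
by rewrite /Tj /T1 /T2; case: ifP => _; rewrite /symc /= i_n.
Qed.

(* [T'_m] is connected, so a closed set that meets a copy of it contains it. *)
Lemma contains_Tprime_inv m G :
  3 <= m -> contains (Tprime m) G ->
  exists2 v, m - 2 <= #|nbrs G v| &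
    forall A : {set 'I_N}, v \in A ->
      (forall x y, x \in A -> G x y -> y \in A) -> m <= #|A|.
Proof.
move=> m3 [f [injf homf]]; have m0 : 0 < m by apply: leq_trans m3.
have leaf (i : 'I_m) : 0 < i <= m - 2 -> Tprime m (Ordinal m0) i.
  by rewrite /Tprime /symc /= => ->.
exists (f (Ordinal m0)).
  by apply: contains_center_degree injf homf _ leaf; clear - m3; lia.
move=> A vA clA; rewrite -{1}(card_ord m) -cardsT -(card_imset _ injf).
have inner (i : 'I_m) : i <= m - 2 -> f i \in A.
  case: (posnP i) => [i0 _|i_gt0 im]; last by apply: clA vA _; apply/homf/leaf/andP.
  by rewrite (_ : i = Ordinal m0) //; apply: val_inj.
apply/subset_leq_card/subsetP => _ /imsetP[i _ ->].
have [|im] := leqP i (m - 2); first exact: inner.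
have m2 : m - 2 < m by clear - m3; lia.
apply: clA (inner (Ordinal m2) (leqnn _)) _; apply: homf.
rewrite /Tprime /symc /= eqxx (_ : val i == m - 1) ?orbT //=.
by have := ltn_ord i; clear - im m3; lia.
Qed.

(** The degree hypothesis keeps all blue degrees at most [n - 4], too small for the centre of
    [Tj j n]. *)
Lemma not_ramsey_prop_of_graph m n j G M :
  5 <= n -> symmetric G -> irreflexive G -> ~ contains (Tprime m) G ->
  (forall v, N + 3 <= #|nbrs G v| + n) ->
  M <= N -> ~ ramsey_prop (Tprime m) (Tj j n) M.
Proof.
move=> n5 sG iG noT deg MN /(ramsey_prop_mono MN) /(_ G sG iG)[//|].
case/(contains_Tj_degree n5) => v dv.
have := deg v; have := card_nbrs_compl v iG; move: dv n5.
by move: #|_| #|_|; clear; lia.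
Qed.

End NoRamsey.

(** * Existence of regular graphs *)

Lemma card_ord_interval N a b : b <= N -> #|[set z : 'I_N | a <= z < b]| = b - a.
Proof.
move=> bN; rewrite -sum1_card big_mkcond.
rewrite (eq_bigr (fun z : 'I_N => if a <= z < b then 1 else 0)); last first.
  by move=> z _; rewrite inE.
rewrite -(big_mkord xpredT (fun z => if a <= z < b then 1 else 0)) -big_mkcond /=.
have [ba|ab] := leqP b a.
  rewrite big_pred0 => [|z]; first by clear - ba; lia.
  by apply/negbTE; clear - ba; lia.
rewrite -big_nat_widen //.
have /= <- := @big_nat_widenl _ 0 addn a 0 b xpredT (fun=> 1) (leq0n a).
by rewrite sum_nat_const_nat muln1.
Qed.

Definition regular N (G : rel 'I_N) d : Prop :=
  [/\ symmetric G, irreflexive G & forall v, #|nbrs G v| = d].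

(* The Cayley graph of Z/N for the symmetric connection set {k+1, ..., N-k-1}. *)
Lemma exists_regular_interval N k :
  0 < N -> exists G : rel 'I_N, regular G (N - k - k.+1).
Proof.
case: N => // p _.
pose G := fun x y : 'I_p.+1 => k < (y - x)%R < p.+1 - k.
have sG : symmetric G.
  move=> x y; rewrite /G -(GRing.opprB x y); move: (x - y)%R => z.
  have zp : z < p.+1 := ltn_ord z.
  rewrite /=; have [z0|z0] := posnP z; first by rewrite z0 subn0 modnn.
  rewrite modn_small; first by clear - z0 zp; lia.
  by clear - z0 zp; lia.
exists G; split=> [//|x|x]; first by rewrite /G GRing.subrr.
rewrite -(card_ord_interval k.+1 (leq_subr k p.+1)).
(* Translation by [- x] carries the neighbours of [x] onto the connection set. *)
rewrite -[RHS](card_preimset _ (GRing.addIr (- x)%R)).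
by apply: eq_card => y; rewrite !inE.
Qed.

(** The Cayley graphs have degree [N - 1 - 2k], which covers even [N - 1 - d]. Otherwise [N] and [d]
    are both even, and the complement of the graph with [k = d / 2] has degree [d]. *)
Lemma exists_regular N d :
  d < N -> ~~ odd (N * d) -> exists G : rel 'I_N, regular G d.
Proof.
move=> dN par; have N0 : 0 < N by apply: leq_trans dN.
have [odd1|even1] := boolP (odd (N - d.+1)).
  have [G [sG iG dG]] := exists_regular_interval d./2 N0.
  exists (compl G); split=> [||v]; [exact: compl_sym|exact: compl_irr|].
  have := card_nbrs_compl v iG; rewrite dG; move: par; rewrite oddM.
  by move: #|_| odd1 dN; clear; lia.
have [G rG] := exists_regular_interval ((N - d.+1)./2) N0.
exists G; rewrite (_ : d = N - (N - d.+1)./2 - ((N - d.+1)./2).+1) //.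
by move: even1 dN; clear; lia.
Qed.

(** * Disjoint union of a clique and a given graph *)

Definition disjoint_clique a b (R : rel 'I_b) : rel 'I_(a + b) := fun x y =>
  match split x, split y with
  | inl i, inl j => i != j
  | inr i, inr j => R i j
  | _, _ => false
  end.

Section DisjointClique.
Variables (a b : nat) (R : rel 'I_b).
Let G := @disjoint_clique a b R.

Lemma disjoint_cliqueE :
  [/\ forall i j, G (lshift b i) (lshift b j) = (i != j),
      forall i j, G (lshift b i) (rshift a j) = false,
      forall i j, G (rshift a j) (lshift b i) = false
    & forall i j, G (rshift a i) (rshift a j) = R i j].
Proof.
have sl i : split (lshift b i) = inl i by apply: (unsplitK (inl i)).
have sr i : split (rshift a i) = inr i by apply: (unsplitK (inr i)).
by split=> i j; rewrite /G /disjoint_clique ?sl ?sr.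
Qed.

Lemma disjoint_clique_sym : symmetric R -> symmetric G.
Proof.
by move=> sR x y; rewrite /G /disjoint_clique; do 2 case: split => ? //; rewrite eq_sym.
Qed.

Lemma disjoint_clique_irr : irreflexive R -> irreflexive G.
Proof.
by move=> iR x; rewrite /G /disjoint_clique; case: split => ?; rewrite ?eqxx ?iR.
Qed.

Lemma card_nbrs_lshift i : #|nbrs G (lshift b i)| = a.-1.
Proof.
have [ll lr _ _] := disjoint_cliqueE.
have <- : #|[set~ i]| = a.-1 by rewrite cardsC1 card_ord.
rewrite -(card_imset _ (@lshift_inj a b)).
apply: eq_card => y; rewrite inE; case: (split_ordP y) => j ->.
  by rewrite ll (mem_imset _ _ (@lshift_inj a b)) !inE eq_sym.
rewrite lr; apply/esym/negbTE/imsetP => -[z _ /eqP].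
by rewrite eq_rlshift.
Qed.

Lemma card_nbrs_rshift i : #|nbrs G (rshift a i)| = #|nbrs R i|.
Proof.
have [_ _ rl rr] := disjoint_cliqueE.
rewrite -(card_imset _ (@rshift_inj a b)).
apply: eq_card => y; rewrite inE; case: (split_ordP y) => j ->.
  rewrite rl; apply/esym/negbTE/imsetP => -[z _ /eqP].
  by rewrite eq_lrshift.
by rewrite rr (mem_imset _ _ (@rshift_inj a b)) inE.
Qed.

(** Degrees in [R] are too small for the centre of [Tprime m], and the clique is a closed set of
    fewer than [m] vertices. *)
Lemma disjoint_clique_noTprime m :
  3 <= m -> a < m -> (forall i, #|nbrs R i| < m - 2) -> ~ contains (Tprime m) G.
Proof.
move=> m3 am dR /(contains_Tprime_inv m3)[v dv clo].
have [ll lr _ _] := disjoint_cliqueE.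
case: (split_ordP v) dv clo => i ->; last first.
  by rewrite card_nbrs_rshift leqNgt dR.
move=> _ /(_ (lshift b @: setT)) clo; have : m <= a.
  rewrite -{1}(card_ord a) -cardsT -(card_imset _ (@lshift_inj a b)); apply: clo.
    exact: imset_f.
  move=> _ y /imsetP[z _ ->]; case: (split_ordP y) => k ->; first by rewrite imset_f.
  by rewrite lr.
by rewrite leqNgt am.
Qed.

End DisjointClique.

(** * Lower bounds and conclusion *)

Lemma regular_noTprime N (G : rel 'I_N) m :
  3 <= m -> regular G (m - 3) -> ~ contains (Tprime m) G.
Proof.
move=> m3 [_ _ dG] /(contains_Tprime_inv m3)[v + _]; rewrite dG.
by clear - m3; lia.
Qed.

Lemma not_ramsey_prop_of_regular N m n j M :
  5 <= n -> 3 <= m -> m - 3 < N -> ~~ odd (N * (m - 3)) -> N + 3 <= m - 3 + n ->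
  M <= N -> ~ ramsey_prop (Tprime m) (Tj j n) M.
Proof.
move=> n5 m3 mN par Nmn; have [G rG] := exists_regular mN par.
have noT := regular_noTprime m3 rG; have [sG iG dG] := rG.
by apply: (not_ramsey_prop_of_graph n5 sG iG noT) => v; rewrite dG.
Qed.

(** The parity hypothesis rules out exactly [n = m + 1] with [m] even, where the Ramsey number is
    smaller. *)
Lemma not_ramsey_prop_Tprime_Tj m n j M :
  7 <= m -> m < n -> [|| odd m, ~~ odd n | m + 3 <= n] ->
  M <= m + n - 6 -> ~ ramsey_prop (Tprime m) (Tj j n) M.
Proof.
move=> m7 mn par MN; have [n5 m3] : 5 <= n /\ 3 <= m by clear - m7 mn; lia.
have [parN|oddN] := boolP (~~ odd ((m + n - 6) * (m - 3))).
  by apply: not_ramsey_prop_of_regular parN _ MN => //; clear - m7 mn; lia.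
(* Now [m] is even and [n] odd, so [n >= m + 3]: there is an [(m - 3)]-regular graph on the even
   number [n - 5] of vertices, and K_{m-1} is added to it. *)
rewrite negbK oddM in oddN; have evn : ~~ odd ((n - 5) * (m - 3)).
  by rewrite oddM; clear - oddN m7 mn; lia.
have [|R [sR iR dR]] := exists_regular _ evn; first by clear - par oddN m7 mn; lia.
have eqN : m + n - 6 = (m - 1) + (n - 5) by clear - m7 mn; lia.
rewrite eqN in MN; move: MN.
apply: not_ramsey_prop_of_graph (disjoint_clique_sym sR) (disjoint_clique_irr iR) _ _ => //.
  apply: disjoint_clique_noTprime => // [|i]; first by clear - m7; lia.
  by rewrite dR; clear - m7; lia.
move=> v; case: (split_ordP v) => i ->.
  by rewrite card_nbrs_lshift; clear - m7 mn; lia.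
by rewrite card_nbrs_rshift dR; clear - m7 mn; lia.
Qed.

Theorem theorem6p3 (m j : nat) (hj : j = 1 \/ j = 2) :
  (odd m -> 9 <= m -> ramsey_eq (Tprime m) (Tj j (m + 1)) (2 * m - 4)) /\
  (~~ odd m -> 16 <= m -> ramsey_eq (Tprime m) (Tj j (m + 1)) (2 * m - 5)) /\
  (forall n : nat, 7 <= m -> maxn (m + 2) (19 - m) <= n -> ~~ (m - 1 %| n - 4) ->
     ramsey_eq (Tprime m) (Tj j n) (m + n - 5)).
Proof.
split; [|split].
- move=> om m9; have -> : 2 * m - 4 = m + (m + 1) - 5 by lia.
  split; first by lia.
  split; first apply: ramsey_prop_Tprime_Tj; try by lia.
    (* For [n = m + 1] the number [n - 4 = m - 3] is positive and below [m - 1]. *)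
    by apply/negP => /dvdn_leq; lia.
  by move=> N N_lt; apply: not_ramsey_prop_Tprime_Tj; rewrite ?om //; lia.
- move=> em m16; split; first by lia.
  split; first exact: ramsey_prop_Tprime_Tj_even.
  (* The order [2 * m - 6] is even, so an [(m - 3)]-regular graph exists. *)
  move=> N N_lt; apply: (@not_ramsey_prop_of_regular (2 * m - 6)); rewrite ?oddM; lia.
move=> n m7 n_ge ndvd; move: n_ge; rewrite geq_max => /andP[mn _].
split; first by lia.
split; first by apply: ramsey_prop_Tprime_Tj => //; lia.
by move=> N N_lt; apply: not_ramsey_prop_Tprime_Tj; lia.
Qed.
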